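(* The equivariant cohomology functor $H_G^\ast:\mathbf{Pers}\text{-}\mathbf{Top}_G\to\mathbf{Pers}_G$ is $1$-Lipschitz with respect to the interleaving distances. Specifically, for any two persistence $G$-spaces $\mathcal{X},\mathcal{Y}:(\mathbb{R},\leq)\to\mathbf{Top}_G$, we have $$d_I\big(H_G^\ast(\mathcal{X}),H_G^\ast(\mathcal{Y})\big)\leq d_I(\mathcal{X},\mathcal{Y}).$$
   Context: $G$ is a Hausdorff topological group and $\mathbb{K}$ a fixed coefficient field. $\mathbf{Top}_G$ is the category of left $G$-spaces and $G$-equivariant continuous maps. For a $G$-space $X$, $H_G^\ast(X)=H^\ast(EG\times_GX;\mathbb{K})$ is its Borel equivariant cohomology, a graded module over $\mathcal{H}_G^\ast=H^\ast(BG;\mathbb{K})$; it is contravariantly functorial in $X$. A persistence $G$-space is a functor $\mathcal{X}:(\mathbb{R},\leq)\to\mathbf{Top}_G$; these form the category $\mathbf{Pers}\text{-}\mathbf{Top}_G$ with natural transformations as morphisms. $H_G^\ast(\mathcal{X}):(\mathbb{R},\leq)^{\mathrm{op}}\to\mathbf{Mod}^{\mathrm{gr}}_{\mathcal{H}_G^\ast}$ is $t\mapsto H_G^\ast(\mathcal{X}(t))$, with structure maps $H_G^\ast(\mathcal{X}(t))\to H_G^\ast(\mathcal{X}(s))$, $s\leq t$, the pullbacks along $\mathcal{X}(s\leq t)$; $\mathbf{Pers}_G$ is the category of such (contravariant) persistence graded $\mathcal{H}_G^\ast$-modules, and $H_G^\ast$ is a contravariant functor from $\mathbf{Pers}\text{-}\mathbf{Top}_G$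 to $\mathbf{Pers}_G$. Persistence $G$-spaces $\mathcal{X},\mathcal{Y}$ are $\varepsilon$-interleaved if there are natural families of equivariant maps $\phi_t:\mathcal{X}(t)\to\mathcal{Y}(t+\varepsilon)$ and $\psi_t:\mathcal{Y}(t)\to\mathcal{X}(t+\varepsilon)$ such that $\psi_{t+\varepsilon}\circ\phi_t$ and $\phi_{t+\varepsilon}\circ\psi_t$ are the structure maps $\mathcal{X}(t)\to\mathcal{X}(t+2\varepsilon)$ and $\mathcal{Y}(t)\to\mathcal{Y}(t+2\varepsilon)$. For contravariant persistence modules $\mathcal{A},\mathcal{B}$ the definition is the same with arrows reversed: natural families of graded module maps $\mathcal{B}(t+\varepsilon)\to\mathcal{A}(t)$ and $\mathcal{A}(t+\varepsilon)\to\mathcal{B}(t)$ whose composites are the structure maps $\mathcal{A}(t+2\varepsilon)\to\mathcal{A}(t)$ and $\mathcal{B}(t+2\varepsilon)\to\mathcal{B}(t)$. In both cases $d_I$ is the infimum of all $\varepsilon\geq0$ for which an $\varepsilon$-interleaving exists. *)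

(* Defs.v *)
From HB Require Import structures.
From mathcomp Require Import all_boot all_order all_algebra ring_quotient.
From mathcomp Require Import all_classical reals ereal topology normedtype.
From mathcomp Require Import zify.

Set Implicit Arguments.
Unset Strict Implicit.
Unset Printing Implicit Defensive.
Import Order.TTheory GRing.Theory Num.Theory.
Import numFieldNormedType.Exports.
Local Open Scope classical_set_scope.
Local Open Scope quotient_scope.
Local Open Scope ring_scope.

(* Singular cohomology (with cup product) of arbitrary topological spaces,
   Borel equivariant cohomology, and interleavings of persistence objects,
   over an abstract field of reals [R] and coefficient field [K]. *)

Section Simplex.
Variable R : realType.

Definition stdSimplex (n : nat) : set {ptws 'I_n.+1 -> R} :=
  [set t | (forall i, 0 <= t i) /\ \sum_i t i = 1].
Arguments stdSimplex : clear implicits.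

(* The affine map of standard simplices sending vertex [i] to vertex [f i]. *)
Lemma simplexMap_subproof m n (f : 'I_m.+1 -> 'I_n.+1) (t : stdSimplex m) :
  (fun j => \sum_(i | f i == j) \val t i : R) \in stdSimplex n.
Proof.
case: t => t /= /set_mem [t0 t1]; apply/mem_set; split=> [j|].
  by apply: sumr_ge0 => i _; apply: t0.
by rewrite -t1 (partition_big f predT).
Qed.

Definition simplexMap m n (f : 'I_m.+1 -> 'I_n.+1) (t : stdSimplex m) :
  stdSimplex n := @exist _ (fun s => s \in stdSimplex n) _ (simplexMap_subproof f t).

Lemma sum_continuous (T : topologicalType) (I : Type) (r : seq I) (P : pred I)
    (F : I -> T -> R) : (forall i, continuous (F i)) ->
  continuous (fun t => \sum_(i <- r | P i) F i t).
Proof.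
move=> Fc; elim: r => [|i r IHr].
  under [fun _ => _]funext => s do rewrite big_nil.
  exact: cst_continuous.
under [fun _ => _]funext => s do rewrite big_cons.
by case: (P i) => // t; apply: cvgD; [exact: Fc|exact: IHr].
Qed.

Lemma simplexMap_continuous m n (f : 'I_m.+1 -> 'I_n.+1) :
  continuous (simplexMap f).
Proof.
apply: continuous_comp_initial => t.
have FF : Filter ((set_val \o simplexMap f) x @[x --> t]).
  exact: (@fmap_filter _ _ _ (nbhs t)).
apply/cvg_sup => j; move: t {FF}.
apply: (@continuous_comp_initial _ _ _ (fun x : {ptws 'I_n.+1 -> R} => x j)
  (set_val \o simplexMap f)) => {}t.
have -> : (fun x : {ptws 'I_n.+1 -> R} => x j) \o (set_val \o simplexMap f) =
  fun t => \sum_(i | f i == j) proj i (set_val t).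
  by apply/funext => s /=; rewrite set_valE.
apply: sum_continuous => i s; apply: continuous_comp.
  exact: initial_continuous.
exact: (@proj_continuous _ (fun=> R)).
Qed.

HB.instance Definition _ m n (f : 'I_m.+1 -> 'I_n.+1) :=
  isContinuous.Build _ _ (simplexMap f) (@simplexMap_continuous m n f).

Lemma simplexMap_id n (f : 'I_n.+1 -> 'I_n.+1) : f =1 id -> simplexMap f =1 id.
Proof.
move=> fid t; apply/val_inj/funext => j /=.
by under eq_bigl => i do rewrite fid; rewrite big_pred1_eq.
Qed.

Lemma simplexMap_comp l m n (f : 'I_l.+1 -> 'I_m.+1) (g : 'I_m.+1 -> 'I_n.+1) :
  simplexMap (g \o f) =1 simplexMap g \o simplexMap f.
Proof.
move=> t; apply/val_inj/funext => k /=.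
rewrite (partition_big f (fun j => g j == k)) //=.
apply: eq_bigr => j /eqP gj; apply: eq_bigl => i.
case: (eqVneq (f i) j) => [->|_]; rewrite ?andbF ?andbT //=. by rewrite gj eqxx.
Qed.

End Simplex.
Arguments stdSimplex : clear implicits.

Section Cohomology.
Variables (R : realType) (K : fieldType).

Definition singular n (X : topologicalType) := continuousType (stdSimplex R n) X.

Definition reparam m n (X : topologicalType) (f : 'I_m.+1 -> 'I_n.+1)
  (s : singular n X) : singular m X := s \o simplexMap f.

(* [K^o] is [K] as a module over itself. *)
Definition cochain n (X : topologicalType) := singular n X -> K^o.
HB.instance Definition _ n X := GRing.Lmodule.on (cochain n X).

Definition delta n X (c : cochain n X) : cochain n.+1 X :=
  fun s => \sum_(i < n.+2) (-1) ^+ i * c (reparam (lift i) s).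

Lemma delta_linear n X : linear (@delta n X).
Proof.
move=> a c d; apply/funext => s.
rewrite /delta -[RHS]/(a * _ + _) mulr_sumr -big_split; apply: eq_bigr => i _.
by rewrite -[(a *: c + d) _]/(a * _ + _) mulrDr !mulrA [a * _]mulrC.
Qed.
HB.instance Definition _ n X :=
  GRing.isLinear.Build K (cochain n X) (cochain n.+1 X) *:%R (@delta n X) (@delta_linear n X).

Definition is_cocycle n X : {pred cochain n X} := fun c => `[< delta c = 0 >].
Fact is_cocycle_submod n X : submod_closed (@is_cocycle n X).
Proof.
split=> [|a c d /asboolP dc /asboolP dd]; apply/asboolP; first exact: linear0.
by rewrite linearP /= dc dd scaler0 addr0.
Qed.
HB.instance Definition _ n X := GRing.isSubmodClosed.Build K (cochain n X)
  (@is_cocycle n X) (@is_cocycle_submod n X).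

Record cocycle n X := Cocycle
  {cocycle_val :> cochain n X; _ : cocycle_val \in @is_cocycle n X}.
HB.instance Definition _ n X := [isSub for @cocycle_val n X].
HB.instance Definition _ n X := [Choice of cocycle n X by <:].
HB.instance Definition _ n X := [SubChoice_isSubLmodule of cocycle n X by <:].

(* There are no cochains in degree -1, so only 0 bounds in degree 0. *)
Definition is_coboundary n X : {pred cocycle n X} :=
  match n return {pred cocycle n X} with
  | 0 => fun c => `[< (c : cochain 0 X) = 0 >]
  | n'.+1 => fun c => `[< exists b : cochain n' X, (c : cochain n'.+1 X) = delta b >]
  end.
Fact is_coboundary_submod n X : submod_closed (@is_coboundary n X).
Proof.
case: n => [|n]; split.
- by apply/asboolP.
- move=> a c d /asboolP c0 /asboolP d0; apply/asboolP.
  by rewrite -[LHS]/(a *: (c : cochain 0 X) + (d : cochain 0 X)) c0 d0 scaler0 addr0.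
- by apply/asboolP; exists 0; rewrite linear0.
- move=> a c d /asboolP[b cb] /asboolP[b' db]; apply/asboolP.
  exists (a *: b + b'); by rewrite linearP /= -cb -db.
Qed.
HB.instance Definition _ n X := GRing.isSubmodClosed.Build K (cocycle n X)
  (@is_coboundary n X) (@is_coboundary_submod n X).

Definition cohomology n X := Quotient.quot (@is_coboundary n X).
HB.instance Definition _ n X := EqQuotient.on (cohomology n X).
HB.instance Definition _ n X := GRing.Zmodule.on (cohomology n X).
HB.instance Definition _ n X := ZmodQuotient.on (cohomology n X).

Lemma eq_cohomology n X (c d : cocycle n X) :
  \pi_(cohomology n X) c = \pi_(cohomology n X) d <-> c - d \in @is_coboundary n X.
Proof. by rewrite (Quotient.idealrBE (@is_coboundary n X)); split=> /eqP. Qed.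

Section Scale.
Variables (n : nat) (X : topologicalType).
Local Notation H := (cohomology n X).

Definition coh_scale (a : K) (x : H) : H := \pi_H (a *: repr x).

Lemma pi_scale a (c : cocycle n X) : coh_scale a (\pi_H c) = \pi_H (a *: c).
Proof.
apply/eq_cohomology; rewrite -scalerBr; apply: rpredZ.
by apply/eq_cohomology; rewrite reprK.
Qed.

Fact coh_scaleA a b x : coh_scale a (coh_scale b x) = coh_scale (a * b) x.
Proof. by rewrite -[x]reprK !pi_scale scalerA reprK. Qed.
Fact coh_scale1 : left_id 1 coh_scale.
Proof. by move=> x; rewrite -[x]reprK pi_scale scale1r. Qed.
Fact coh_scaleDr : right_distributive coh_scale +%R.
Proof.
by move=> a x y; rewrite -[x]reprK -[y]reprK -raddfD !pi_scale scalerDr raddfD.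
Qed.
Fact coh_scaleDl x : {morph coh_scale^~ x : a b / a + b}.
Proof. by move=> a b; rewrite -[x]reprK !pi_scale scalerDl raddfD. Qed.
HB.instance Definition _ := GRing.Zmodule_isLmodule.Build K H
  coh_scaleA coh_scale1 coh_scaleDr coh_scaleDl.

Lemma pi_linear : linear (\pi_H : cocycle n X -> H).
Proof. by move=> a x y; rewrite raddfD /= -pi_scale. Qed.
HB.instance Definition _ := GRing.isLinear.Build K (cocycle n X) H *:%R \pi_H pi_linear.
End Scale.


Lemma reparam_id n X (f : 'I_n.+1 -> 'I_n.+1) (s : singular n X) :
  f =1 id -> reparam f s = s.
Proof. by move=> fid; apply/continuousEP => t /=; rewrite simplexMap_id. Qed.

Lemma reparam_comp l m n X (f : 'I_l.+1 -> 'I_m.+1) (g : 'I_m.+1 -> 'I_n.+1)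
  (s : singular n X) : reparam f (reparam g s) = reparam (g \o f) s.
Proof. by apply/continuousEP => t /=; rewrite simplexMap_comp. Qed.

Lemma eq_reparam m n X (f g : 'I_m.+1 -> 'I_n.+1) (s : singular n X) :
  f =1 g -> reparam f s = reparam g s.
Proof. by move=> /funext ->. Qed.

(* Vertices 0, ..., p and p, ..., p + q of the n-simplex; used when p + q = n. *)
Definition front p n (i : 'I_p.+1) : 'I_n.+1 := inord i.
Definition back p q n (i : 'I_q.+1) : 'I_n.+1 := inord (p + i).

(* The Alexander-Whitney cup product when p + q = n. Keeping n as a separate
   index avoids casts between the types of degree (p + q) + r and p + (q + r);
   the same device is used for all graded multiplications below. *)
Definition cup p q n X (c : cochain p X) (d : cochain q X) : cochain n X :=
  fun s => c (reparam (@front p n) s) * d (reparam (@back p q n) s).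
Arguments cup {p q} n {X}.

Lemma cup_linearl p q n X (d : cochain q X) :
  linear (fun c : cochain p X => cup n c d).
Proof. by move=> a c c'; apply/funext => s; rewrite /cup mulrDl -[RHS]/(a * _ + _) mulrA. Qed.

Lemma cup_linearr p q n X (c : cochain p X) :
  linear (fun d : cochain q X => cup n c d).
Proof.
move=> a d d'; apply/funext => s.
by rewrite /cup mulrDr -[RHS]/(a * _ + _) mulrA [c _ * a]mulrC -mulrA.
Qed.

Lemma cupA p q r pq qr n X (epq : (p + q = pq)%N) (eqr : (q + r = qr)%N)
    (en : (pq + r = n)%N) (a : cochain p X) (b : cochain q X) (c : cochain r X) :
  cup n a (cup qr b c) = cup n (cup pq a b) c.
Proof.
apply/funext => s; rewrite /cup mulrA !reparam_comp.
have leqn (i m : nat) : (i <= m -> m <= n -> i < n.+1)%N by move=> /leq_trans/[apply].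
congr (_ * _ * _); [congr a|congr b|congr c]; apply: eq_reparam => i;
  apply/val_inj; have := ltn_ord i; rewrite /= !ltnS => ile.
- by rewrite ?inordK //; lia.
- by rewrite ?inordK //; lia.
- by rewrite ?inordK //; lia.
Qed.

Definition cochain1 X : cochain 0 X := fun=> 1.

Lemma cup1c n X (c : cochain n X) : cup n (@cochain1 X) c = c.
Proof.
apply/funext => s; rewrite /cup mul1r reparam_id // => i.
by apply/val_inj; rewrite /back /= add0n inordK.
Qed.

Lemma cupc1 n X (c : cochain n X) : cup n c (@cochain1 X) = c.
Proof.
apply/funext => s; rewrite /cup mulr1 reparam_id // => i.
by apply/val_inj; rewrite /front /= inordK.
Qed.

Lemma delta_cup p q n X (e : (p + q = n)%N) (c : cochain p X) (d : cochain q X) :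
  delta (cup n c d) = cup n.+1 (delta c) d + (-1) ^+ p *: cup n.+1 c (delta d).
Proof.
apply/funext => s.
rewrite -[RHS]/(_ * _ + (-1) ^+ p * (_ * _)) /delta /cup.
pose F i : K := (-1) ^+ i * (c (reparam (@front p n) (reparam (lift (inord i)) s)) *
  d (reparam (@back p q n) (reparam (lift (inord i)) s))).
pose T := c (reparam (@front p n.+1) s) * d (reparam (@back p.+1 q n.+1) s).
have -> : \sum_(i < n.+2) (-1) ^+ i *
    (c (reparam (@front p n) (reparam (lift i) s)) *
     d (reparam (@back p q n) (reparam (lift i) s))) =
   \sum_(0 <= i < p.+1) F i + \sum_(0 <= i < q.+1) F (p.+1 + i)%N.
  have -> : \sum_(0 <= i < q.+1) F (p.+1 + i)%N = \sum_(p.+1 <= i < n.+2) F i.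
    rewrite -[in RHS](add0n p.+1) big_addn (_ : (n.+2 - p.+1 = q.+1)%N); last by lia.
    by apply: eq_bigr => i _; rewrite addnC.
  rewrite -big_cat_nat //=; last by lia.
  by rewrite big_mkord; apply: eq_bigr => i _; rewrite /F inord_val.
rewrite mulr_suml big_ord_recr /=.
rewrite [in X in _ = _ + X]big_ord_recl /= expr0 mul1r mulrDr mulrDr.
rewrite (_ : _ * d _ = (-1) ^+ p.+1 * T); last first.
  rewrite /T -mulrA reparam_comp; congr (_ * (c _ * _)).
  apply: eq_reparam => i; apply/val_inj.
  rewrite /front /back /= /bump leqNgt ltn_ord add0n inordK //.
  by have := ltn_ord i; lia.
rewrite (_ : (-1) ^+ p * (_ * d (reparam (lift ord0) _)) = (-1) ^+ p * T); last first.
  rewrite /T reparam_comp; congr (_ * (_ * d _)).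
  apply: eq_reparam => i; apply/val_inj.
  rewrite /front /back /= /bump leq0n add1n.
  by have := ltn_ord i => ?; rewrite !inordK; lia.
rewrite exprS mulN1r mulNr addrA addrNK.
congr (_ + _).
- rewrite big_mkord; apply: eq_bigr => i _; rewrite /F -mulrA !reparam_comp.
  have := ltn_ord i => ilt.
  congr (_ * (c _ * d _)); apply: eq_reparam => j; apply/val_inj;
    have := ltn_ord j; rewrite /front /back /= /bump => jlt;
    rewrite ?inordK; lia.
- rewrite big_mkord !mulr_sumr; apply: eq_bigr => i _; rewrite /F !reparam_comp.
  have := ltn_ord i => ilt.
  rewrite [in RHS](mulrCA (c _)) [RHS]mulrA -exprD /bump leq0n.
  rewrite (_ : (p + (1 + i) = p.+1 + i)%N); last by lia.
  congr (_ * (c _ * d _)); apply: eq_reparam => j; apply/val_inj;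
    have := ltn_ord j; rewrite /front /back /= /bump => jlt;
    rewrite ?inordK; lia.
Qed.


Lemma cocycleP n X (c : cocycle n X) : delta c = 0.
Proof. exact/asboolP/(valP c). Qed.

Lemma cup0c p q n X (d : cochain q X) : cup n (0 : cochain p X) d = 0.
Proof. by apply/funext => s; rewrite /cup mul0r. Qed.

Lemma cupc0 p q n X (c : cochain p X) : cup n c (0 : cochain q X) = 0.
Proof. by apply/funext => s; rewrite /cup mulr0. Qed.

Fact cup_cocycle_subproof p q n X (e : (p + q = n)%N) (c : cocycle p X)
  (d : cocycle q X) : cup n c d \in @is_cocycle n X.
Proof.
by apply/asboolP; rewrite delta_cup // !cocycleP cup0c cupc0 scaler0 addr0.
Qed.

Definition cup_cocycle p q n X (e : (p + q = n)%N) (c : cocycle p X)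
  (d : cocycle q X) : cocycle n X := Cocycle (cup_cocycle_subproof e c d).

Lemma coboundary0P X (c : cocycle 0 X) :
  reflect ((c : cochain 0 X) = 0) (c \in @is_coboundary 0 X).
Proof. exact: asboolP. Qed.

Lemma coboundarySP n X (c : cocycle n.+1 X) :
  reflect (exists b : cochain n X, (c : cochain n.+1 X) = delta b)
          (c \in @is_coboundary n.+1 X).
Proof. exact: asboolP. Qed.

Lemma cup_coboundaryl p q n X (e : (p + q = n)%N) (c : cocycle p X) (d : cocycle q X) :
  c \in @is_coboundary p X -> cup_cocycle e c d \in @is_coboundary n X.
Proof.
case: p e c => [|p] e c.
  move=> /coboundary0P c0; suff -> : cup_cocycle e c d = 0 by apply: rpred0.
  by apply/val_inj; rewrite /= c0 cup0c.
case: n e => // n e /coboundarySP[b cb]; apply/coboundarySP; exists (cup n b d).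
rewrite /= delta_cup; last by lia.
by rewrite cocycleP cupc0 scaler0 addr0 cb.
Qed.

Lemma cup_coboundaryr p q n X (e : (p + q = n)%N) (c : cocycle p X) (d : cocycle q X) :
  d \in @is_coboundary q X -> cup_cocycle e c d \in @is_coboundary n X.
Proof.
case: q e d => [|q] e d.
  move=> /coboundary0P d0; suff -> : cup_cocycle e c d = 0 by apply: rpred0.
  by apply/val_inj; rewrite /= d0 cupc0.
case: n e => [|n] e /coboundarySP[b db]; first by lia.
apply/coboundarySP; exists ((-1) ^+ p *: cup n c b).
rewrite linearZ /= delta_cup; last by lia.
rewrite cocycleP cup0c add0r db.
by rewrite scalerA -exprD addnn -mul2n exprM sqrrN expr1n expr1n scale1r.
Qed.

Definition coh_cup p q n X (e : (p + q = n)%N) (x : cohomology p X)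
  (y : cohomology q X) : cohomology n X :=
  \pi_(cohomology n X) (cup_cocycle e (repr x) (repr y)).

Lemma pi_cup p q n X (e : (p + q = n)%N) (c : cocycle p X) (d : cocycle q X) :
  coh_cup e (\pi_(cohomology p X) c) (\pi_(cohomology q X) d) =
  \pi_(cohomology n X) (cup_cocycle e c d).
Proof.
rewrite /coh_cup; set c' := repr _; set d' := repr _.
have cc : c' - c \in @is_coboundary p X by apply/eq_cohomology; rewrite reprK.
have dd : d' - d \in @is_coboundary q X by apply/eq_cohomology; rewrite reprK.
apply/eq_cohomology.
have -> : cup_cocycle e c' d' - cup_cocycle e c d =
    cup_cocycle e (c' - c) d' + cup_cocycle e c (d' - d).
  apply/val_inj/funext => s.
  by rewrite -[LHS]/(_ * _ - _ * _) -[RHS]/((_ - _) * _ + _ * (_ - _));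
     rewrite mulrBl mulrBr addrA subrK.
by apply: rpredD; [exact: cup_coboundaryl|exact: cup_coboundaryr].
Qed.

Lemma coh_cup_linearl p q n X (e : (p + q = n)%N) (y : cohomology q X) :
  linear (fun x : cohomology p X => coh_cup e x y).
Proof.
move=> a x x'; rewrite -[x]reprK -[x']reprK -[y]reprK -linearP !pi_cup -linearP.
by congr (\pi _); apply/val_inj; rewrite /= cup_linearl.
Qed.

Lemma coh_cup_linearr p q n X (e : (p + q = n)%N) (x : cohomology p X) :
  linear (fun y : cohomology q X => coh_cup e x y).
Proof.
move=> a y y'; rewrite -[x]reprK -[y]reprK -[y']reprK -linearP !pi_cup -linearP.
by congr (\pi _); apply/val_inj; rewrite /= cup_linearr.
Qed.

Lemma coh_cupA p q r pq qr n X (epq : (p + q = pq)%N) (eqr : (q + r = qr)%N)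
    (en : (pq + r = n)%N) (en' : (p + qr = n)%N) (x : cohomology p X)
    (y : cohomology q X) (z : cohomology r X) :
  coh_cup en' x (coh_cup eqr y z) = coh_cup en (coh_cup epq x y) z.
Proof.
rewrite -[x]reprK -[y]reprK -[z]reprK !pi_cup ?reprK.
by congr (\pi _); apply/val_inj; rewrite /= (cupA epq eqr en).
Qed.

Fact cochain1_subproof X : @cochain1 X \in @is_cocycle 0 X.
Proof.
apply/asboolP/funext => s.
by rewrite /delta /cochain1 big_ord_recl big_ord1 /= expr0 expr1 !mulr1 subrr.
Qed.

Definition coh1 X : cohomology 0 X :=
  \pi_(cohomology 0 X) (Cocycle (cochain1_subproof X)).

Lemma coh_cup1x n X (e : (0 + n = n)%N) (x : cohomology n X) :
  coh_cup e (coh1 X) x = x.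
Proof.
rewrite -[x]reprK pi_cup.
by congr (\pi _); apply/val_inj; rewrite /= cup1c.
Qed.

Lemma coh_cupx1 n X (e : (n + 0 = n)%N) (x : cohomology n X) :
  coh_cup e x (coh1 X) = x.
Proof.
rewrite -[x]reprK pi_cup.
by congr (\pi _); apply/val_inj; rewrite /= cupc1.
Qed.

Section Pullback.
Variables (X Y : topologicalType) (f : continuousType X Y).

Definition cochain_pullback n (c : cochain n Y) : cochain n X :=
  fun s => c (f \o s).

Lemma delta_pullback n (c : cochain n Y) :
  delta (cochain_pullback c) = cochain_pullback (delta c).
Proof.
apply/funext => s; apply: eq_bigr => i _; congr (_ * c _).
exact/continuousEP.
Qed.

Fact cocycle_pullback_subproof n (c : cocycle n Y) :
  cochain_pullback c \in @is_cocycle n X.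
Proof. by apply/asboolP; rewrite delta_pullback cocycleP. Qed.

Definition cocycle_pullback n (c : cocycle n Y) : cocycle n X :=
  Cocycle (cocycle_pullback_subproof c).

Lemma cocycle_pullback_linear n : linear (@cocycle_pullback n).
Proof. by move=> a c d; apply/val_inj. Qed.

Lemma coboundary_pullback n (c : cocycle n Y) :
  c \in @is_coboundary n Y -> cocycle_pullback c \in @is_coboundary n X.
Proof.
case: n c => [|n] c => [/coboundary0P c0|/coboundarySP[b cb]].
  apply/coboundary0P.
  by rewrite /= c0.
by apply/coboundarySP; exists (cochain_pullback b); rewrite delta_pullback -cb.
Qed.

Definition pullback n (x : cohomology n Y) : cohomology n X :=
  \pi_(cohomology n X) (cocycle_pullback (repr x)).

Lemma pi_pullback n (c : cocycle n Y) :
  pullback (\pi_(cohomology n Y) c) = \pi_(cohomology n X) (cocycle_pullback c).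
Proof.
apply/eq_cohomology.
have -> : cocycle_pullback (repr (\pi_(cohomology n Y) c)) - cocycle_pullback c =
  cocycle_pullback (repr (\pi_(cohomology n Y) c) - c) by apply/val_inj.
by apply/coboundary_pullback/eq_cohomology; rewrite reprK.
Qed.

Lemma pullback_linear n : linear (@pullback n).
Proof.
move=> a x y; rewrite -[x]reprK -[y]reprK -linearP !pi_pullback -linearP.
by congr (\pi _); rewrite cocycle_pullback_linear.
Qed.
HB.instance Definition _ n := GRing.isLinear.Build K (cohomology n Y)
  (cohomology n X) *:%R (@pullback n) (@pullback_linear n).

Lemma pullback_cup p q n (e : (p + q = n)%N) (x : cohomology p Y)
  (y : cohomology q Y) :
  pullback (coh_cup e x y) = coh_cup e (pullback x) (pullback y).
Proof.
rewrite -[x]reprK -[y]reprK pi_cup !pi_pullback pi_cup.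
congr (\pi _); apply/val_inj/funext => s; rewrite /= /cochain_pullback /cup.
by congr (_ * _); congr (cocycle_val _ _); apply/continuousEP.
Qed.

Lemma pullback1 : pullback (coh1 Y) = coh1 X.
Proof. by rewrite pi_pullback; congr (\pi _); apply/val_inj. Qed.

End Pullback.

Lemma pullback_id n (X : topologicalType) (f : continuousType X X) (x : cohomology n X) :
  f =1 id -> pullback f x = x.
Proof.
move=> fid; rewrite -[x]reprK pi_pullback; congr (\pi _); apply/val_inj/funext.
by move=> s; rewrite /= /cochain_pullback; congr (cocycle_val _ _); apply/continuousEP => t; rewrite /= fid.
Qed.

Lemma pullback_comp n (X Y Z : topologicalType) (f : continuousType X Y) (g : continuousType Y Z)
    (h : continuousType X Z) (x : cohomology n Z) :
  h =1 g \o f -> pullback h x = pullback f (pullback g x).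
Proof.
move=> hE; rewrite -[x]reprK !pi_pullback ?reprK; congr (\pi _); apply/val_inj/funext.
by move=> s; rewrite /= /cochain_pullback; congr (cocycle_val _ _); apply/continuousEP => t; rewrite /= hE.
Qed.

End Cohomology.

Section GradedModules.
Variable K : fieldType.

Record gradedAlg := GradedAlg {
  alg_deg :> nat -> lmodType K;
  alg_one : alg_deg 0;
  alg_mul : forall p q n, (p + q = n)%N -> alg_deg p -> alg_deg q -> alg_deg n;
  alg_mul_linearl : forall p q n (e : (p + q = n)%N) (y : alg_deg q),
    linear (fun x => alg_mul e x y);
  alg_mul_linearr : forall p q n (e : (p + q = n)%N) (x : alg_deg p),
    linear (alg_mul e x);
  alg_mulA : forall p q r pq qr n (epq : (p + q = pq)%N) (eqr : (q + r = qr)%N)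
      (el : (pq + r = n)%N) (er : (p + qr = n)%N) x y z,
    alg_mul er x (alg_mul eqr y z) = alg_mul el (alg_mul epq x y) z;
  alg_mul1 : forall n (e : (0 + n = n)%N) x, alg_mul e alg_one x = x;
  alg_mulr1 : forall n (e : (n + 0 = n)%N) x, alg_mul e x alg_one = x
}.

Variable A : gradedAlg.

Record gradedMod := GradedMod {
  mod_deg :> nat -> lmodType K;
  mod_act : forall p q n, (p + q = n)%N -> A p -> mod_deg q -> mod_deg n;
  mod_act_linearl : forall p q n (e : (p + q = n)%N) (x : mod_deg q),
    linear (fun a => mod_act e a x);
  mod_act_linearr : forall p q n (e : (p + q = n)%N) (a : A p),
    linear (mod_act e a);
  mod_actA : forall p q r pq qr n (epq : (p + q = pq)%N) (eqr : (q + r = qr)%N)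
      (el : (pq + r = n)%N) (er : (p + qr = n)%N) a b x,
    mod_act er a (mod_act eqr b x) = mod_act el (alg_mul epq a b) x;
  mod_act1 : forall n (e : (0 + n = n)%N) x, mod_act e (alg_one A) x = x
}.

Record gradedHom (M N : gradedMod) := GradedHom {
  hom_deg :> forall n, {linear M n -> N n};
  hom_act : forall p q n (e : (p + q = n)%N) (a : A p) (x : M q),
    hom_deg n (mod_act e a x) = mod_act e a (hom_deg q x)
}.

End GradedModules.

Section CohomologyAlgebra.
Variables (R : realType) (K : fieldType).

Definition cohAlg (X : topologicalType) : gradedAlg K :=
  @GradedAlg K (fun n => cohomology R K n X) (coh1 R K X)
    (fun p q n e x y => coh_cup e x y)
    (fun p q n e y => coh_cup_linearl e y)
    (fun p q n e x => coh_cup_linearr e x)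
    (fun p q r pq qr n epq eqr el er x y z => coh_cupA epq eqr el er x y z)
    (fun n e x => coh_cup1x e x) (fun n e x => coh_cupx1 e x).

(* H^*(X) as a left H^*(B)-module: a . x = f^*(a) \cup x, for f : X -> B. *)
Section Module.
Variables (B X : topologicalType) (f : continuousType X B).
Let act p q n (e : (p + q = n)%N) (a : cohAlg B p) (x : cohomology R K q X) :=
  coh_cup e (pullback f a) x.

Fact act_linearl p q n (e : (p + q = n)%N) (x : cohomology R K q X) :
  linear (fun a => act e a x).
Proof. by move=> k a b; rewrite /act linearP coh_cup_linearl. Qed.

Fact act_linearr p q n (e : (p + q = n)%N) (a : cohAlg B p) : linear (act e a).
Proof. exact: coh_cup_linearr. Qed.

Fact actA p q r pq qr n (epq : (p + q = pq)%N) (eqr : (q + r = qr)%N)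
    (el : (pq + r = n)%N) (er : (p + qr = n)%N) a b x :
  act er a (act eqr b x) = act el (alg_mul epq a b) x.
Proof. by rewrite /act [alg_mul _ _ _]/(coh_cup _ _ _) pullback_cup (coh_cupA epq _ el). Qed.

Fact act1 n (e : (0 + n = n)%N) x : act e (alg_one (cohAlg B)) x = x.
Proof. by rewrite /act pullback1 coh_cup1x. Qed.

Definition cohMod : gradedMod (cohAlg B) :=
  GradedMod act_linearl act_linearr actA act1.
End Module.

Section Hom.
Variables (B X Y : topologicalType).
Variables (fX : continuousType X B) (fY : continuousType Y B) (g : continuousType X Y).
Hypothesis fg : fX =1 fY \o g.

Fact pullback_act p q n (e : (p + q = n)%N) (a : cohAlg B p) (x : cohMod fY q) :
  pullback g (mod_act e a x) = @mod_act _ _ (cohMod fX) _ _ _ e a (pullback g x).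
Proof. by rewrite /= pullback_cup (pullback_comp _ fg). Qed.

Definition cohHom : gradedHom (cohMod fY) (cohMod fX) :=
  @GradedHom K (cohAlg B) (cohMod fY) (cohMod fX)
    (fun n => @pullback R K X Y g n : {linear cohomology R K n Y -> cohomology R K n X}) pullback_act.
End Hom.
End CohomologyAlgebra.

HB.mixin Record isTopologicalGroup G of Group G & Topological G := {
  mulg_continuous : continuous (fun p : G * G => (p.1 * p.2)%g);
  invg_continuous : continuous (fun g : G => (g^-1)%g)
}.
#[short(type="topologicalGroupType")]
HB.structure Definition TopologicalGroup :=
  {G of isTopologicalGroup G & Group G & Topological G}.

Section GSpaces.
Variable G : topologicalGroupType.

Record gSpace := GSpace {
  gspace_sort :> topologicalType;
  gact : G -> gspace_sort -> gspace_sort;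
  gact1 : forall x, gact 1%g x = x;
  gactM : forall g h x, gact (g * h)%g x = gact g (gact h x);
  gact_continuous : continuous (fun p : G * gspace_sort => gact p.1 p.2)
}.

Record gMap (X Y : gSpace) := GMap {
  gmap_fun :> X -> Y;
  gmap_continuous : continuous gmap_fun;
  gmap_equivariant : forall g x, gmap_fun (gact g x) = gact g (gmap_fun x)
}.

HB.instance Definition _ X Y (f : gMap X Y) :=
  isContinuous.Build X Y f (@gmap_continuous X Y f).

Definition orbit_rel (X : gSpace) : rel X := fun x y => `[< exists g, gact g x = y >].

Fact orbit_rel_equiv (X : gSpace) : equiv_class_of (@orbit_rel X).
Proof.
split=> [x|x y|y x z].
- by apply/asboolP; exists 1%g; rewrite gact1.
- by apply/asboolP/asboolP => -[g <-]; exists g^-1%g; rewrite -gactM mulVg gact1.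
- move=> /asboolP[g gxy] /asboolP[h hyz]; apply/asboolP; exists (h * g)%g.
  by rewrite gactM gxy.
Qed.
Canonical orbit_rel_equivRel X := EquivRelPack (orbit_rel_equiv X).

Definition orbitSpace (X : gSpace) : topologicalType :=
  quotient_topology {eq_quot (@orbit_rel X)}.

Definition orbit_pi (X : gSpace) : X -> orbitSpace X := \pi_{eq_quot (@orbit_rel X)}.

Lemma orbit_piP (X : gSpace) (x y : X) : orbit_pi x = orbit_pi y <-> exists g, gact g x = y.
Proof. by split=> [/eqmodP/asboolP//|xy]; apply/eqmodP/asboolP. Qed.

Lemma orbit_reprK (X : gSpace) (q : orbitSpace X) : orbit_pi (repr q) = q.
Proof. exact: reprK. Qed.

Definition orbitMap (X Y : gSpace) (f : gMap X Y) : orbitSpace X -> orbitSpace Y :=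
  fun q => orbit_pi (f (repr q)).

Lemma orbitMapE (X Y : gSpace) (f : gMap X Y) (x : X) : orbitMap f (orbit_pi x) = orbit_pi (f x).
Proof.
apply/orbit_piP.
have /orbit_piP[g gx] := orbit_reprK (orbit_pi x).
by exists g; rewrite -gmap_equivariant gx.
Qed.

Lemma orbitMap_continuous X Y (f : gMap X Y) : continuous (orbitMap f).
Proof.
apply/quotient_continuous.
rewrite (_ : _ \o _ = @orbit_pi Y \o f); last first.
  by apply/funext => x; exact: orbitMapE.
move=> x; apply: continuous_comp; first exact: gmap_continuous.
exact: pi_continuous.
Qed.

HB.instance Definition _ X Y (f : gMap X Y) :=
  isContinuous.Build _ _ (orbitMap f) (@orbitMap_continuous X Y f).

Section Product.
Variables X Y : gSpace.
Let act (g : G) (p : X * Y) : X * Y := (gact g p.1, gact g p.2).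

Fact prod_act1 p : act 1%g p = p.
Proof. by case: p => x y; rewrite /act !gact1. Qed.
Fact prod_actM g h p : act (g * h)%g p = act g (act h p).
Proof. by rewrite /act !gactM. Qed.
Fact prod_act_continuous : continuous (fun p : G * (X * Y) => act p.1 p.2).
Proof.
move=> p; apply: cvg_pair.
  apply: (@continuous_comp _ _ _ (fun p : G * (X * Y) => (p.1, p.2.1))
            (fun p : G * X => gact p.1 p.2)); last exact: gact_continuous.
  apply: cvg_pair; first exact: cvg_fst.
  by apply: continuous_comp; [exact: cvg_snd|exact: cvg_fst].
apply: (@continuous_comp _ _ _ (fun p : G * (X * Y) => (p.1, p.2.2))
          (fun p : G * Y => gact p.1 p.2)); last exact: gact_continuous.
apply: cvg_pair; first exact: cvg_fst.
by apply: continuous_comp; [exact: cvg_snd|exact: cvg_snd].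
Qed.

Definition prodGSpace : gSpace :=
  @GSpace (X * Y)%type act prod_act1 prod_actM prod_act_continuous.

Definition fstGMap : gMap prodGSpace X :=
  @GMap prodGSpace X fst (fun _ => cvg_fst) (fun _ _ => erefl).
End Product.

Section ProductMap.
Variables (E X Y : gSpace) (f : gMap X Y).
Let pmap (p : E * X) : E * Y := (p.1, f p.2).

Fact prodGMap_continuous : continuous pmap.
Proof.
move=> p; apply: cvg_pair; first exact: cvg_fst.
by apply: continuous_comp; [exact: cvg_snd|exact: gmap_continuous].
Qed.
Fact prodGMap_equivariant g (p : prodGSpace E X) :
  (pmap (gact g p) : prodGSpace E Y) = gact g (pmap p : prodGSpace E Y).
Proof. by rewrite /pmap /= gmap_equivariant. Qed.

Definition prodGMap : gMap (prodGSpace E X) (prodGSpace E Y) :=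
  @GMap (prodGSpace E X) (prodGSpace E Y) pmap prodGMap_continuous prodGMap_equivariant.
End ProductMap.

End GSpaces.

Section BorelCohomology.
Variables (R : realType) (K : fieldType) (G : topologicalGroupType).

Definition contractible (X : topologicalType) :=
  exists (x0 : X) (h : R * X -> X),
    [/\ {within `[0, 1] `*` setT, continuous h},
        forall x, h (0, x) = x & forall x, h (1, x) = x0].

(* [phi] is a G-homeomorphism from U x G onto the part of E over U, with
   inverse e |-> (orbit_pi e, tau e). *)
Definition trivial_over (E : gSpace G) (U : set (orbitSpace E)) :=
  exists (phi : orbitSpace E * G -> E) (tau : E -> G),
    [/\ {within U `*` setT, continuous phi},
        {within @orbit_pi G E @^-1` U, continuous tau},
        forall u g h, U u -> phi (u, (g * h)%g) = gact g (phi (u, h)),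
        forall u g, U u -> orbit_pi (phi (u, g)) = u /\ tau (phi (u, g)) = g &
        forall e, U (orbit_pi e) -> phi (orbit_pi e, tau e) = e].

(* E -> E/G is a locally trivial principal G-bundle with contractible total
   space, i.e. a model of EG -> BG. Numerability is not demanded: it does not
   affect the singular cohomology of the Borel construction. *)
Definition universal_bundle (E : gSpace G) :=
  contractible E /\
  forall b : orbitSpace E, exists U, [/\ open U, U b & trivial_over U].

Variable EG : gSpace G.

(* EG x_G X. As EG is a left G-space here, this is the quotient of EG x X by the
   diagonal action; the right action on EG is e . g = g^-1 e. *)
Definition borelSpace (X : gSpace G) : topologicalType :=
  orbitSpace (prodGSpace EG X).

Definition classifyingSpace : topologicalType := orbitSpace EG.

Definition coeffAlg : gradedAlg K := cohAlg R K classifyingSpace.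

(* H^*(EG x_G X), with H^*(BG) acting through the projection EG x_G X -> BG. *)
Definition equivCoh (X : gSpace G) : gradedMod coeffAlg :=
  cohMod R K (orbitMap (fstGMap EG X)).

Fact borelMap_fst (X Y : gSpace G) (f : gMap X Y) :
  orbitMap (fstGMap EG X) =1 orbitMap (fstGMap EG Y) \o orbitMap (prodGMap EG f).
Proof. by move=> q; rewrite -[q]orbit_reprK /= !orbitMapE. Qed.

Definition equivCohMap (X Y : gSpace G) (f : gMap X Y) :
    gradedHom (equivCoh Y) (equivCoh X) :=
  cohHom R K (borelMap_fst f).

Lemma equivCohMap_id (X : gSpace G) (f : gMap X X) n (x : equivCoh X n) :
  f =1 id -> equivCohMap f n x = x.
Proof.
move=> fid; apply: pullback_id => q; rewrite -[q]orbit_reprK /= orbitMapE /=.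
by rewrite fid -surjective_pairing.
Qed.

Lemma equivCohMap_comp (X Y Z : gSpace G) (f : gMap X Y) (g : gMap Y Z)
    (h : gMap X Z) n (x : equivCoh Z n) : h =1 g \o f ->
  equivCohMap h n x = equivCohMap f n (equivCohMap g n x).
Proof.
move=> hE; apply: pullback_comp => q; rewrite -[q]orbit_reprK /= !orbitMapE.
by rewrite /= hE.
Qed.

End BorelCohomology.

Section Persistence.
Variable R : realType.

Section GSpaces.
Variable G : topologicalGroupType.

Record persGSpace := PersGSpace {
  pspace :> R -> gSpace G;
  pspace_map : forall s t, s <= t -> gMap (pspace s) (pspace t);
  pspace_id : forall t (tt : t <= t) x, pspace_map tt x = x;
  pspace_comp : forall r s t (rs : r <= s) (st : s <= t) (rt : r <= t) x,
    pspace_map rt x = pspace_map st (pspace_map rs x)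
}.

(* The shift by 2 * eps is written t + eps + eps, the codomain of the composite.
   Proofs of inequalities are irrelevant, hence quantified universally. *)
Definition gspace_interleaved (X Y : persGSpace) (eps : R) :=
  exists (phi : forall t, gMap (X t) (Y (t + eps)))
         (psi : forall t, gMap (Y t) (X (t + eps))),
    [/\ forall s t (st : s <= t) (st' : s + eps <= t + eps) x,
          phi t (pspace_map X st x) = pspace_map Y st' (phi s x),
        forall s t (st : s <= t) (st' : s + eps <= t + eps) y,
          psi t (pspace_map Y st y) = pspace_map X st' (psi s y),
        forall t (tt : t <= t + eps + eps) x,
          psi (t + eps) (phi t x) = pspace_map X tt x &
        forall t (tt : t <= t + eps + eps) y,
          phi (t + eps) (psi t y) = pspace_map Y tt y].

(* The value is +oo when no interleaving exists. *)
Definition gspace_dI (X Y : persGSpace) : \bar R :=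
  ereal_inf [set eps%:E | eps in [set eps | 0 <= eps /\ gspace_interleaved X Y eps]].

End GSpaces.

Section Modules.
Variables (K : fieldType) (A : gradedAlg K).

Record persMod := PersMod {
  pmod :> R -> gradedMod A;
  pmod_map : forall s t, s <= t -> gradedHom (pmod t) (pmod s);
  pmod_id : forall t (tt : t <= t) n x, pmod_map tt n x = x;
  pmod_comp : forall r s t (rs : r <= s) (st : s <= t) (rt : r <= t) n x,
    pmod_map rt n x = pmod_map rs n (pmod_map st n x)
}.

(* Contravariant modules: the structure maps decrease the parameter. *)
Definition mod_interleaved (M N : persMod) (eps : R) :=
  exists (phi : forall t, gradedHom (N (t + eps)) (M t))
         (psi : forall t, gradedHom (M (t + eps)) (N t)),
    [/\ forall s t (st : s <= t) (st' : s + eps <= t + eps) n x,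
          phi s n (pmod_map N st' n x) = pmod_map M st n (phi t n x),
        forall s t (st : s <= t) (st' : s + eps <= t + eps) n y,
          psi s n (pmod_map M st' n y) = pmod_map N st n (psi t n y),
        forall t (tt : t <= t + eps + eps) n x,
          phi t n (psi (t + eps) n x) = pmod_map M tt n x &
        forall t (tt : t <= t + eps + eps) n y,
          psi t n (phi (t + eps) n y) = pmod_map N tt n y].

Definition mod_dI (M N : persMod) : \bar R :=
  ereal_inf [set eps%:E | eps in [set eps | 0 <= eps /\ mod_interleaved M N eps]].

End Modules.

Definition persEquivCoh (K : fieldType) (G : topologicalGroupType) (EG : gSpace G)
    (X : persGSpace G) : persMod (coeffAlg R K EG) :=
  @PersMod K (coeffAlg R K EG) (fun t => equivCoh R K EG (X t))
    (fun s t st => equivCohMap R K EG (pspace_map X st))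
    (fun t tt n x => equivCohMap_id x (pspace_id tt))
    (fun r s t rs st rt n x => equivCohMap_comp x (pspace_comp rs st rt)).

End Persistence.

(* Main.v *)
Require Import Defs.
From HB Require Import structures.
From mathcomp Require Import all_boot all_order all_algebra.
From mathcomp Require Import all_classical reals ereal topology normedtype.

(** Functors preserve interleavings: an [eps]-interleaving of persistence
    G-spaces consists of equivariant maps making two squares and two triangles
    commute, and the contravariant functor [equivCohMap] turns these into the
    squares and triangles of an [eps]-interleaving of the cohomology modules
    ([gspace_interleaved_coh]). The order of each composite is reversed, which
    is what the contravariant definition asks for. Hence every [eps] admissible
    in the infimum for the spaces is admissible for the modules, and an infimum
    over a larger set is smaller. *)

Set Implicit Arguments.
Unset Strict Implicit.
Unset Printing Implicit Defensive.

Local Open Scope ring_scope.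

Lemma gMap_comp_continuous (G : topologicalGroupType) (X Y Z : gSpace G)
    (g : gMap Y Z) (f : gMap X Y) : continuous (g \o f).
Proof. by move=> x; apply: continuous_comp; apply: gmap_continuous. Qed.

Lemma gMap_comp_equivariant (G : topologicalGroupType) (X Y Z : gSpace G)
    (g : gMap Y Z) (f : gMap X Y) a x :
  (g \o f) (gact a x) = gact a ((g \o f) x).
Proof. by rewrite /= !gmap_equivariant. Qed.

Definition gMap_comp (G : topologicalGroupType) (X Y Z : gSpace G)
    (g : gMap Y Z) (f : gMap X Y) : gMap X Z :=
  @GMap G X Z (g \o f) (@gMap_comp_continuous G X Y Z g f)
    (@gMap_comp_equivariant G X Y Z g f).

(** Both composites are the map induced by the diagonal of the square. *)
Lemma equivCohMap_square (R : realType) (K : fieldType)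
    (G : topologicalGroupType) (EG X Y Y' Z : gSpace G)
    (f : gMap X Y) (g : gMap Y Z) (f' : gMap X Y') (g' : gMap Y' Z)
    n (z : equivCoh R K EG Z n) :
  g \o f =1 g' \o f' ->
  equivCohMap R K EG f n (equivCohMap R K EG g n z) =
  equivCohMap R K EG f' n (equivCohMap R K EG g' n z).
Proof.
move=> gf; rewrite -(@equivCohMap_comp R K G EG _ _ _ f g (gMap_comp g f)) //.
exact: equivCohMap_comp.
Qed.

Lemma gspace_interleaved_coh (R : realType) (K : fieldType)
    (G : topologicalGroupType) (EG : gSpace G) (X Y : persGSpace R G) (eps : R) :
  gspace_interleaved X Y eps ->
  mod_interleaved (persEquivCoh K EG X) (persEquivCoh K EG Y) eps.
Proof.
move=> [phi [psi [phi_nat psi_nat psi_phi phi_psi]]].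
exists (fun t => equivCohMap R K EG (phi t)).
exists (fun t => equivCohMap R K EG (psi t)).
split=> [s t st st' n x|s t st st' n y|t tt n x|t tt n y].
- by apply: equivCohMap_square => u /=; rewrite (phi_nat _ _ _ st').
- by apply: equivCohMap_square => u /=; rewrite (psi_nat _ _ _ st').
- by symmetry; apply: equivCohMap_comp => u /=; rewrite (psi_phi _ tt).
- by symmetry; apply: equivCohMap_comp => u /=; rewrite (phi_psi _ tt).
Qed.

Theorem proposition3p3p5 (R : realType) (K : fieldType)
    (G : topologicalGroupType) (hG : hausdorff_space G)
    (EG : gSpace G) (hEG : universal_bundle R EG)
    (X Y : persGSpace R G) :
  (mod_dI (persEquivCoh K EG X) (persEquivCoh K EG Y) <= gspace_dI X Y)%E.
Proof.
apply: ereal_inf_le_tmp => _ [eps [eps0 XY] <-].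
by exists eps => //; split=> //; exact: gspace_interleaved_coh.
Qed.
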